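(* Suppose $J:\mathcal{P}(\mathcal{X})\to\mathbb{R}$ is $L$-smooth but not necessarily convex, let $\mu^*\in\arg\min_{\mu\in\mathcal{P}(\mathcal{X})}J(\mu)$ and $R=\sup\{\|\mu_1-\mu_2\|:\mu_1,\mu_2\in\mathcal{P}(\mathcal{X})\}$, and suppose there exists $c_0<\infty$ such that for all $\mu\in\mathcal{P}(\mathcal{X})$ (and all $m\ge1$) $\mathbb{E}[\sqrt m\,\|H_{\mu,m}-h_\mu\|_\infty]\le c_0$. Let $T\ge1$ be an integer, $\mu_0\in\mathcal{P}(\mathcal{X})$, and let $\{\mu_k\}$ be generated by the stochastic Frank-Wolfe recursion $$\mu_{k+1}=(1-\eta_k)\mu_k+\eta_k\,\delta_{\hat x_{k+1}(m)},\qquad \hat x_{k+1}(m)\in\arg\min_{x\in\mathcal{X}}H_{\mu_k,m}(x),$$ with parameters $$\eta_k=\eta=\sqrt{\frac{2(J(\mu_0)-J(\mu^* ))}{L\,R^2\,T}},\qquad m_k=m=T\qquad\text{for all }k\in\{0,\dots,T-1\}.$$ Then $$\mathbb{E}\left[G(\mu_a)\right]\le\frac{R}{\sqrt T}\left(c_0+\sqrt{2L(J(\mu_0)-J(\mu^* ))}\right),$$ where $\mu_a$ is chosen uniformly at random from $\{\mu_k\}_{k=0}^{T-1}$ and $G$ is the Frank-Wolfe gap $G(\mu):=\max_{\nu\in\mathcal{P}(\mathcal{X})}-J'_\mu(\nu)$.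
   Context: $\mathcal{X}$ is a nonempty compact subset of $\mathbb{R}^d$ with Borel $\sigma$-algebra $\mathcal{B}(\mathcal{X})$, $\mathcal{P}(\mathcal{X})$ is the set of Borel probability measures on $\mathcal{X}$, and $\delta_x$ is the Dirac measure at $x$. The influence function of $J$ at $\mu$ is $h_\mu(x)=\lim_{t\to0^+}\frac1t\{J(\mu+t(\delta_x-\mu))-J(\mu)\}$, $x\in\mathcal{X}$. The von Mises derivative of $J$ at $\mu$ is $J'_\mu(\nu)=\lim_{t\to0^+}\frac1t\{J(\mu+t(\nu-\mu))-J(\mu)\}$; it exists at $\mu$ if these limits exist for all $\nu\in\mathcal{P}(\mathcal{X})$ and there is a measurable $\phi_\mu:\mathcal{X}\to\mathbb{R}$, integrable with respect to every $\nu\in\mathcal{P}(\mathcal{X})$, with $J'_\mu(\nu)=\int\phi_\mu\,\mathrm{d}(\nu-\mu)$. Then $h_\mu=\phi_\mu-\int\phi_\mu\,\mathrm{d}\mu$ and $J'_\mu(\nu)=\int h_\mu\,\mathrm{d}\nu$. Total variation distance: $\|\mu_1-\mu_2\|:=\sup_{A\in\mathcal{B}(\mathcal{X})}|\mu_1(A)-\mu_2(A)|$. $J$ is $L$-smooth ($L>0$) if $\sup_{x\in\mathcal{X}}|h_{\mu_1}(x)-h_{\mu_2}(x)|\le L\|\mu_1-\mu_2\|$ for all $\mu_1,\mu_2\in\mathcal{P}(\mathcal{X})$. Stochastic oracle: $Y$ is a random element of a measurable space, $H_\mu(\cdot,Y):\mathcal{X}\to\mathbb{R}$ is a random function with $\mathbb{E}[H_\mu(x,Y)]=h_\mu(x)$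 for all $\mu,x$, and $H_{\mu,m}(x)=\frac1m\sum_{j=1}^m H_\mu(x,Y_j)$ with $Y_1,\dots,Y_m$ i.i.d. copies of $Y$; $\|g\|_\infty=\sup_{x\in\mathcal{X}}|g(x)|$. At each iteration $k$, $H_{\mu_k,m}$ is formed from $m$ fresh i.i.d. copies of $Y$, independent of the samples used to construct $\mu_0,\dots,\mu_k$. The random index selecting $\mu_a$ is independent of these samples. Standing assumptions: the von Mises derivative of $J$ exists at every $\mu\in\mathcal{P}(\mathcal{X})$, the minimum of each $H_{\mu_k,m}$ over $\mathcal{X}$ and the maximum defining $G$ are attained, $R>0$, $\eta\le1$ (so that iterates stay in $\mathcal{P}(\mathcal{X})$), and all random quantities are measurable. *)

(* Defs.v *)
From HB Require Import structures.
From mathcomp Require Import all_boot all_order all_algebra.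
From mathcomp Require Import all_classical all_reals all_analysis.
From mathcomp Require Import measurable_realfun.

Set Implicit Arguments.
Unset Strict Implicit.
Unset Printing Implicit Defensive.
Import Order.TTheory GRing.Theory Num.Theory.
Import numFieldNormedType.Exports.
Local Open Scope classical_set_scope.
Local Open Scope ring_scope.

(* MathComp-Analysis requires measurable spaces to be pointed, so the subspace
   of R^d carried by X takes the proof that X is nonempty as a parameter. *)
Definition subspace_of (R : realType) (d : nat) (X : set 'rV[R]_d)
  (X0 : X !=set0) : Type := set_type X.

Section subspace_of.
Context (R : realType) (d : nat) (X : set 'rV[R]_d) (X0 : X !=set0).

HB.instance Definition _ := Topological.copy (subspace_of X0) (set_type X).
HB.instance Definition _ := isPointed.Build (subspace_of X0)
  (exist _ (sval (cid X0)) (mem_set (svalP (cid X0)))).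

Definition borel : measurableType (@open (subspace_of X0)).-sigma :=
  g_sigma_algebraType (@open (subspace_of X0)).

End subspace_of.

Section mixture.
Context (d : measure_display) (T : measurableType d) (R : realType).
Implicit Types (t : R) (mu nu : probability T R).

Definition clamp t : R := Num.max 0 (Num.min t 1).

Lemma clamp_ge0 t : 0 <= clamp t.
Proof. by rewrite /clamp le_max lexx. Qed.

Lemma onem_clamp_ge0 t : 0 <= 1 - clamp t.
Proof. by rewrite subr_ge0 /clamp ge_max ler01 ge_min lexx orbT. Qed.

Lemma clamp_id t : 0 <= t <= 1 -> clamp t = t.
Proof. by move=> /andP[t0 t1]; rewrite /clamp min_l// max_r. Qed.

(* mu + t (nu - mu); the weight is clamped to [0, 1] only to make this a
   probability measure for every real t. *)
Definition mixture t mu nu : set T -> \bar R :=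
  measure_add (mscale (NngNum (onem_clamp_ge0 t)) mu)
              (mscale (NngNum (clamp_ge0 t)) nu).

Let mixture_clampE t mu nu (A : set T) :
  mixture t mu nu A = ((1 - clamp t)%:E * mu A + (clamp t)%:E * nu A)%E.
Proof. by rewrite /mixture measure_addE. Qed.

Lemma mixtureE t mu nu (A : set T) : 0 <= t <= 1 ->
  mixture t mu nu A = ((1 - t)%:E * mu A + t%:E * nu A)%E.
Proof. by move=> t01; rewrite mixture_clampE clamp_id. Qed.

HB.instance Definition _ t mu nu := Measure.on (mixture t mu nu).

Let mixture_setT t mu nu : mixture t mu nu setT = 1%E.
Proof.
by rewrite mixture_clampE !probability_setT !mule1 -EFinD subrK.
Qed.

HB.instance Definition _ t mu nu :=
  Measure_isProbability.Build d T R (mixture t mu nu) (mixture_setT t mu nu).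

End mixture.

Section functionals.
Context (d : measure_display) (T : measurableType d) (R : realType).
Implicit Types (J : probability T R -> R) (mu nu : probability T R).

Definition vm_quotient J mu nu (t : R) : R :=
  t^-1 * (J (mixture t mu nu) - J mu).

Definition vm_deriv J mu nu : R := lim (vm_quotient J mu nu t @[t --> 0^'+]).

Definition vm_differentiable J mu : Prop :=
  (forall nu, cvg (vm_quotient J mu nu t @[t --> 0^'+])) /\
  exists phi : T -> R, measurable_fun setT phi /\
    forall nu, nu.-integrable setT (EFin \o phi) /\
      vm_deriv J mu nu =
      \int[nu]_(x in setT) phi x - \int[mu]_(x in setT) phi x.

Definition influence J mu (x : T) : R := vm_deriv J mu (dirac x).

Definition tv_dist mu nu : R :=
  sup [set `|fine (mu A) - fine (nu A)| | A in measurable].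

Definition tv_diameter : R :=
  sup [set tv_dist mus.1 mus.2 | mus in [set: probability T R * probability T R]].

(* Extended-real valued, since the supremum of an unbounded set of reals is 0
   in the library. *)
Definition sup_norm (f : T -> R) : \bar R :=
  ereal_sup (range (fun x => `|f x|%:E)).

Definition smooth J (L : R) : Prop :=
  forall mu1 mu2,
    (sup_norm (fun x => (influence J mu1 x - influence J mu2 x)%R) <=
     (L * tv_dist mu1 mu2)%:E)%E.

(* The supremum is the maximum of the definition under gap_attained. *)
Definition gap J mu : R := sup (range (fun nu => - vm_deriv J mu nu)).

Definition gap_attained J mu : Prop :=
  exists nu, forall nu', - vm_deriv J mu nu' <= - vm_deriv J mu nu.

End functionals.

Section independence.
Context (d : measure_display) (Omega : measurableType d) (R : realType).

Definition mutually_independent (P : probability Omega R) (I : finType)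
    (F : I -> set_system Omega) : Prop :=
  forall (K : {set I}) (A : I -> set Omega),
    (forall i, i \in K -> F i (A i)) ->
    P (\bigcap_(i in [set` K]) A i) = (\prod_(i in K) P (A i))%E.

Definition sigma_of (d' : measure_display) (E : measurableType d')
    (Z : Omega -> E) : set_system Omega :=
  preimage_set_system setT Z measurable.

End independence.

Definition same_law (d d' dE : measure_display) (Omega : measurableType d)
    (Omega' : measurableType d') (E : measurableType dE) (R : realType)
    (P : probability Omega R) (P' : probability Omega' R)
    (Y : {RV P >-> E}) (Y' : {RV P' >-> E}) : Prop :=
  forall B, measurable B -> distribution P Y B = distribution P' Y' B.

Section oracle.
Context (d dE : measure_display) (T : measurableType d) (E : measurableType dE).
Context (R : realType).
Implicit Types (H : probability T R -> T -> E -> R) (J : probability T R -> R).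

Definition oracle_mean H (m : nat) (y : m.-tuple E) (mu : probability T R)
    (x : T) : R :=
  m%:R^-1 * \sum_(j < m) H mu x (tnth y j).

Definition oracle_error H J m (y : m.-tuple E) (mu : probability T R) : \bar R :=
  sup_norm (fun x => oracle_mean H y mu x - influence J mu x).

(* Joint measurability of the oracle, of the error norm and of the minimum
   value, the set of probability measures carrying the sigma-algebra generated
   by the evaluations mu |-> mu A.  The minimum is written as an extended-real
   infimum because it is only known to be attained at the iterates. *)
Definition oracle_measurable H J : Prop :=
  measurable_fun setT
    (fun z : pprobability T R * T * E => H z.1.1 z.1.2 z.2) /\
  forall m, (0 < m)%N ->
    measurable_fun setT
      (fun z : pprobability T R * m.-tuple E => oracle_error H J z.2 z.1) /\
    measurable_fun setT
      (fun z : pprobability T R * m.-tuple E =>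
        ereal_inf (range (fun x => (oracle_mean H z.2 z.1 x)%:E))).

Definition unbiased (dO : measure_display) (Omega : measurableType dO)
    (P : probability Omega R) (Y : {RV P >-> E}) H J : Prop :=
  forall mu x, ('E_P[fun w => H mu x (Y w)] = (influence J mu x)%:E)%E.

(* The bound only depends on the law of Y, so the i.i.d. copies may live on an
   arbitrary probability space. *)
Definition oracle_error_bound (dO : measure_display)
    (Omega : measurableType dO) (P : probability Omega R) (Y : {RV P >-> E})
    H J (c0 : R) : Prop :=
  forall (mu : probability T R) (m : nat), (0 < m)%N ->
  forall (d' : measure_display) (Omega' : measurableType d')
         (P' : probability Omega' R) (Z : 'I_m -> {RV P' >-> E}),
    (forall j, same_law Y (Z j)) ->
    mutually_independent P' (fun j => sigma_of (Z j)) ->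
    (\int[P']_w ((Num.sqrt m%:R)%:E *
                 oracle_error H J [tuple Z j w | j < m] mu) <= c0%:E)%E.

End oracle.

(* The sigma-algebra of the samples drawn and the minimizers selected in the
   iterations i < k; the k-th iterate is a function of those minimizers. *)
Definition history (dO dE d : measure_display) (Omega : measurableType dO)
    (E : measurableType dE) (T : measurableType d) (m : nat)
    (Ys : nat -> 'I_m -> Omega -> E) (xhat : nat -> Omega -> T) (k : nat) :
    set_system Omega :=
  <<s [set A | exists2 i, (i < k)%N &
        (exists j, sigma_of (Ys i j) A) \/ sigma_of (xhat i) A] >>.

(* Main.v *)
Require Import Defs.
From HB Require Import structures.
From mathcomp Require Import all_boot all_order all_algebra.
From mathcomp Require Import all_classical all_reals all_analysis.
From mathcomp Require Import measurable_realfun.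
From mathcomp Require Import ring lra.

Set Implicit Arguments.
Unset Strict Implicit.
Unset Printing Implicit Defensive.
Import Order.TTheory GRing.Theory Num.Theory.
Import numFieldNormedType.Exports.
Local Open Scope classical_set_scope.
Local Open Scope ring_scope.

(* The total variation diameter of the set of probability measures, when
   positive, is 1.  Since probability measures mu and nu may satisfy
   |\int f d(nu - mu)| = 2 sup|f| ||nu - mu||, the usual quadratic descent
   inequality with constant L / 2 may fail for an L-smooth J.  It is replaced by
     J(mu_eta) <= J(mu) + (h_mu(x) + L) l - L eta,   l = - ln (1 - eta),
   where mu_eta = (1 - eta) mu + eta delta_x.  It is linear in h_mu(x), so it
   can be summed along the iterates, and l (1 - eta) <= eta - eta^2 / 2 together
   with the choice of eta gives, pathwise,
     sum_{k < T} - h_{mu_k}(x_{k+1}) <= T L eta.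
   The oracle error bounds h_{mu_k}(x_{k+1}) by min H_{mu_k,m} plus
   ||H_{mu_k,m} - h_{mu_k}||, whose mean is at most c0 / sqrt m as the samples
   are fresh.  Finally G(mu) = - inf h_mu is at most - E[min H_{mu,m}], by
   unbiasedness, and the latter is a measurable function of mu, hence its value
   at mu_k is independent of the random index. *)

(** * Mixtures of probability measures and total variation *)

Lemma probability_ext (d : measure_display) (T : measurableType d)
    (R : realType) (m1 m2 : probability T R) :
  (forall A, m1 A = m2 A) -> m1 = m2.
Proof.
move=> /funext; case: m1 m2 => [m1 c1] [m2 c2] /= m12.
move: c2; rewrite -m12 => {m2 m12} c2; congr (Probability.Pack _).
case: c1 c2 => a1 b1 e1 f1 g1 h1 i1 [a2 b2 e2 f2 g2 h2 i2].
(* The mixins contain only proofs about the common underlying function, so proof irrelevance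
   identifies them; [a1] and [a2] come first because the types of the later mixins depend on
   them. *)
have a12 : a1 = a2.
  by case: a1 {b1} => *; case: a2 {b2} => *; congr isContent.Axioms_;
     exact: Prop_irrelevance.
case: _ / a12 in b2 *; congr Probability.Class.
- by case: b1 b2 => ? [?]; congr Content_isMeasure.Axioms_; exact: Prop_irrelevance.
- by case: e1 e2 => ? [?]; congr isSFinite.Axioms_; exact: Prop_irrelevance.
- by case: f1 f2 => ? [?]; congr isSigmaFinite.Axioms_; exact: Prop_irrelevance.
- by case: g1 g2 => ? [?]; congr isFinite.Axioms_; exact: Prop_irrelevance.
- by case: h1 h2 => ? [?]; congr isSubProbability.Axioms_; exact: Prop_irrelevance.
- by case: i1 i2 => ? [?]; congr isProbability.Axioms_; exact: Prop_irrelevance.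
Qed.

Section mixture_theory.
Context (d : measure_display) (T : measurableType d) (R : realType).
Implicit Types (J : probability T R -> R) (mu nu : probability T R).

Lemma mixture0 mu nu : mixture 0 mu nu = mu :> probability T R.
Proof.
apply: probability_ext => A.
by rewrite /= mixtureE ?lexx ?ler01// subr0 mul1e mul0e adde0.
Qed.

Lemma mixture_le0 t mu nu : t <= 0 -> mixture t mu nu = mu :> probability T R.
Proof.
move=> t0; apply: probability_ext => A.
have c0 : clamp t = 0 by rewrite /clamp max_l// ge_min t0.
rewrite /=.
have -> : mixture t mu nu A = ((1 - clamp t)%:E * mu A + (clamp t)%:E * nu A)%E.
  by rewrite /mixture measure_addE.
by rewrite c0 subr0 mul1e mul0e adde0.
Qed.

(** A step from a point of the segment towards its end stays on the segment. This rule and its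
    mirror image below turn von Mises quotients at mu_t into difference quotients in t. *)
Lemma mixture_mixturer s t mu nu : 0 <= s <= 1 -> 0 <= t <= 1 ->
  mixture s (mixture t mu nu) nu = mixture (t + s * (1 - t)) mu nu :> probability T R.
Proof.
move=> s01 t01; apply: probability_ext => A; rewrite /= !mixtureE//=; last by nra.
rewrite mixtureE//.
have ge0 := @measure_ge0 _ _ _.
have s1 : (0 <= (1 - s)%:E :> \bar R)%E by rewrite lee_fin; lra.
rewrite ge0_muleDr ?mule_ge0 ?lee_fin//; [|lra..].
rewrite !muleA -addeA -ge0_muleDl ?mule_ge0 ?lee_fin//; [|nra..].
rewrite -!EFinM -EFinD; congr (_%:E * _ + _%:E * _)%E; ring.
Qed.

Lemma mixture_mixturel s t mu nu : 0 <= s <= 1 -> 0 <= t <= 1 ->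
  mixture s (mixture t mu nu) mu = mixture (t - s * t) mu nu :> probability T R.
Proof.
move=> s01 t01; apply: probability_ext => A; rewrite /= !mixtureE//=; last by nra.
rewrite mixtureE//.
have ge0 := @measure_ge0 _ _ _.
have s1 : (0 <= (1 - s)%:E :> \bar R)%E by rewrite lee_fin; lra.
rewrite ge0_muleDr ?mule_ge0 ?lee_fin//; [|lra..].
rewrite !muleA addeAC -ge0_muleDl ?mule_ge0 ?lee_fin//; [|nra..].
rewrite -!EFinM -EFinD; congr (_%:E * _ + _%:E * _)%E; ring.
Qed.

Lemma integral_mixture t mu nu (f : T -> \bar R) : 0 <= t <= 1 ->
  mu.-integrable setT f -> nu.-integrable setT f ->
  (\int[mixture t mu nu]_x f x =
   (1 - t)%:E * \int[mu]_x f x + t%:E * \int[nu]_x f x)%E.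
Proof.
move=> t01 imu inu; have mf : measurable_fun setT f by exact: measurable_int imu.
(* Scaling is applied to the positive and negative parts separately; integrability makes their
   difference well defined. *)
have sc (k : {nonneg R}) (m : probability T R) : m.-integrable setT f ->
    (mscale k m).-integrable setT f /\
    (\int[mscale k m]_x f x = k%:num%:E * \int[m]_x f x)%E.
  move=> im; split.
    apply/integrableP; split=> //; rewrite ge0_integral_mscale//; last first.
      exact: measurableT_comp.
    by move/integrableP : im => [_ h]; exact: lte_mul_pinfty.
  rewrite integralE [in RHS]integralE muleBr//; last first.
    by rewrite fin_num_adde_defl// fin_numN integrable_neg_fin_num.
  rewrite !ge0_integral_mscale//;
    [exact: measurable_funeneg|exact: measurable_funepos].
rewrite (eq_measure_integral (measure_add (mscale (NngNum (onem_clamp_ge0 t)) mu)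
  (mscale (NngNum (clamp_ge0 t)) nu)))//.
have [i1 e1] := sc (NngNum (onem_clamp_ge0 t)) mu imu.
have [i2 e2] := sc (NngNum (clamp_ge0 t)) nu inu.
by rewrite integral_measure_add// e1 e2/= clamp_id.
Qed.

Lemma Rintegral_mixture t mu nu (f : T -> R) : 0 <= t <= 1 ->
  mu.-integrable setT (EFin \o f) -> nu.-integrable setT (EFin \o f) ->
  \int[mixture t mu nu]_(x in setT) f x =
  (1 - t) * \int[mu]_(x in setT) f x + t * \int[nu]_(x in setT) f x.
Proof.
move=> t01 imu inu; rewrite /Rintegral integral_mixture//.
have mfin := integrable_fin_num measurableT imu.
have nfin := integrable_fin_num measurableT inu.
by rewrite fineD ?fin_numM// !fineM.
Qed.

Lemma fine_probability01 (m : probability T R) (A : set T) : measurable A ->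
  0 <= fine (m A) <= 1.
Proof.
move=> mA.
by rewrite fine_ge0//= -lee_fin fineK ?fin_num_measure// probability_le1.
Qed.

Lemma tv_dist_mixture_le t mu nu : 0 <= t <= 1 -> tv_dist (mixture t mu nu) mu <= t.
Proof.
move=> t01; apply: ge_sup.
  by exists `|fine (mixture t mu nu set0) - fine (mu set0)|; exists set0.
move=> _ [A mA <-]; rewrite /= mixtureE// fineD ?fin_numM ?fin_num_measure//.
rewrite !fineM ?fin_num_measure//=.
have := fine_probability01 mu mA; have := fine_probability01 nu mA.
move: (fine (nu A)) (fine (mu A)) => p q p01 q01.
have -> : (1 - t) * q + t * p - q = t * (p - q) by ring.
by rewrite normrM (ger0_norm (andP t01).1) ler_piMr//; [lra|rewrite ler_norml; lra].
Qed.

Lemma tv_dist_le1 mu nu : tv_dist mu nu <= 1.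
Proof.
apply: ge_sup; first by exists `|fine (mu set0) - fine (nu set0)|; exists set0.
move=> _ [A mA <-]; have := fine_probability01 mu mA.
by have := fine_probability01 nu mA; rewrite ler_norml; lra.
Qed.

(** A positive diameter provides a measurable set A charged differently by two measures, so A and
    its complement are nonempty. Dirac masses at a point of each are at distance 1, the largest
    possible. *)
Lemma tv_diameter_gt0_eq1 : 0 < tv_diameter T R -> tv_diameter T R = 1.
Proof.
have diam_le1 : tv_diameter T R <= 1.
  apply: ge_sup.
    by exists (tv_dist (point : probability T R) point); exists (point, point).
  by move=> _ [[mu nu] _ <-]; exact: tv_dist_le1.
move=> D0; apply/eqP; rewrite eq_le diam_le1/=.
have [mu [nu [A [mA /eqP mnA]]]] : exists mu nu : probability T R, exists A,
    measurable A /\ mu A != nu A.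
  apply: contrapT => h; move: D0; apply/negP; rewrite -leNgt.
  apply: ge_sup.
    by exists (tv_dist (point : probability T R) point); exists (point, point).
  move=> _ [[mu nu] _ <-]; apply: ge_sup.
    by exists `|fine (mu set0) - fine (nu set0)|; exists set0.
  move=> _ [A mA <-]; rewrite (_ : mu A = nu A) ?subrr ?normr0//.
  by apply: contrapT => /eqP mnA; apply: h; exists mu, nu, A.
have [x Ax] : A !=set0.
  by apply/set0P/eqP => A0; apply: mnA; rewrite A0 !measure0.
have [y Ay] : ~` A !=set0.
  apply/set0P/eqP => A0; apply: mnA; have -> : A = setT by rewrite -[A]setCK A0 setC0.
  by rewrite !probability_setT.
apply: (@le_trans _ _ (tv_dist (dirac x : probability T R) (dirac y))).
  apply: ub_le_sup; last first.
    by exists A => //=; rewrite /dirac !indicE mem_set// memNset//= subr0 normr1.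
  exists 1 => _ [B mB <-]; have := fine_probability01 (dirac x : probability T R) mB.
  by have := fine_probability01 (dirac y : probability T R) mB; rewrite ler_norml; lra.
apply: ub_le_sup; last by exists (dirac x : probability T R, dirac y : probability T R).
by exists 1 => _ [[mu' nu'] _ <-]; exact: tv_dist_le1.
Qed.

End mixture_theory.

(** * Differential calculus of J along segments *)

Lemma cvg_at_right0_scale (R : realFieldType) (V : topologicalType) (f : R -> V)
    (c : R) (l : V) : 0 < c ->
  f x @[x --> 0^'+] --> l -> f (c * x) @[x --> 0^'+] --> l.
Proof.
move=> c0; apply: cvg_comp => A [e /= e0 Ae]; exists (e / c); rewrite /= ?divr_gt0//.
move=> x /=; rewrite sub0r normrN => xe x0; apply: Ae; last by rewrite mulr_gt0.
by rewrite /= sub0r normrN normrM (gtr0_norm c0) mulrC -ltr_pdivlMr.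
Qed.

Section vm_calculus.
Context (d : measure_display) (T : measurableType d) (R : realType).
Context (J : probability T R -> R) (J_diff : forall mu, vm_differentiable J mu).
Implicit Types (mu nu : probability T R).

(** The same phi serves all directions, so the direction of a Dirac mass identifies the influence
    function as phi centred at its [mu]-mean. *)
Lemma vm_derivE mu : exists phi : T -> R,
  [/\ forall nu, nu.-integrable setT (EFin \o phi),
      forall nu, vm_deriv J mu nu =
        \int[nu]_(x in setT) phi x - \int[mu]_(x in setT) phi x &
      forall x, influence J mu x = phi x - \int[mu]_(x in setT) phi x].
Proof.
have [_ [phi [mphi phiP]]] := J_diff mu; exists phi; split => [nu|nu|x].
- by have [] := phiP nu.
- by have [] := phiP nu.
have [_] := phiP (dirac x); rewrite /influence => ->; congr (_ - _).
rewrite /Rintegral integral_dirac//; last exact/measurable_EFinP.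
by rewrite diracT mul1e.
Qed.

Lemma vm_deriv_self mu : vm_deriv J mu mu = 0.
Proof. by have [phi [_ -> _]] := vm_derivE mu; rewrite subrr. Qed.

Lemma influence_dirac x : influence J (dirac x) x = 0.
Proof. exact: vm_deriv_self. Qed.

Lemma vm_deriv_influence mu nu :
  nu.-integrable setT (EFin \o influence J mu) /\
  vm_deriv J mu nu = \int[nu]_(x in setT) influence J mu x.
Proof.
have [phi [iphi -> hE]] := vm_derivE mu.
have -> : influence J mu = fun x => phi x - \int[mu]_(x in setT) phi x.
  exact/funext.
set c := Rintegral mu _ _.
have ic : nu.-integrable setT (EFin \o cst c) by exact: finite_measure_integrable_cst.
split; first exact: integrableB (iphi nu) ic.
rewrite RintegralB//= Rintegral_cst//= probability_setT mulr1//.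
Qed.

Lemma vm_quotient_cvg mu nu :
  vm_quotient J mu nu t @[t --> 0^'+] --> vm_deriv J mu nu.
Proof. by have [+ _] := J_diff mu; exact. Qed.

(** Increasing t by h is a step h / (1 - t) from mu_t towards [nu]; decreasing it by h is a step h /
    t towards [mu]. With phi representing the derivative at mu_t, both one-sided derivatives equal
    the integral of phi against [nu] minus that against [mu]. *)
Lemma is_derive_mixture (t : R) mu nu : 0 < t < 1 ->
  is_derive t 1 (fun s : R => J (mixture s mu nu))
    (vm_deriv J (mixture t mu nu) nu / (1 - t)).
Proof.
move=> t01; pose m : probability T R := mixture t mu nu; rewrite -/m.
have t01' : 0 <= t <= 1 by lra.
have [phi [iphi dE _]] := vm_derivE m.
have intm : \int[m]_(x in setT) phi x =
    (1 - t) * \int[mu]_(x in setT) phi x + t * \int[nu]_(x in setT) phi x.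
  by rewrite Rintegral_mixture.
(* moving towards nu or back towards mu gives the two one-sided derivatives *)
have left_right : vm_deriv J m nu / (1 - t) = - (vm_deriv J m mu / t).
  rewrite !dE intm.
  by field; lra.
suff h : h^-1 *: (J (mixture (h *: 1 + t) mu nu) - J m) @[h --> 0^'] -->
    vm_deriv J m nu / (1 - t).
  by apply: DeriveDef; [exact: cvgP h|exact: cvg_lim h].
apply: (@cvg_at_right_left_dnbhs _ R^o).
- have t1 : 0 < (1 - t)^-1 by rewrite invr_gt0; lra.
  have H : (1 - t)^-1 * vm_quotient J m nu ((1 - t)^-1 * h) @[h --> 0^'+] -->
      vm_deriv J m nu / (1 - t).
    rewrite [_ / _]mulrC; apply: cvgM; first exact: cvg_cst.
    exact: (cvg_at_right0_scale t1 (@vm_quotient_cvg m nu)).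
  apply: cvg_trans H; apply: near_eq_cvg; near=> h.
  have h0 : 0 < h by [].
  have h1 : h <= 1 - t by near: h; apply: nbhs_right_le; lra.
  rewrite /vm_quotient mixture_mixturer//; last first.
    apply/andP; split; first by apply: mulr_ge0; exact: ltW.
    by rewrite ler_pdivrMl ?mulr1; lra.
  rewrite (_ : t + _ = h *: 1 + t); last by rewrite /GRing.scale/=; field; lra.
  rewrite /GRing.scale/=; field; lra.
- rewrite left_right; apply/cvg_at_leftNP; rewrite oppr0.
  have t1 : 0 < t^-1 by rewrite invr_gt0; lra.
  have H : - (t^-1 * vm_quotient J m mu (t^-1 * h)) @[h --> 0^'+] -->
      - (vm_deriv J m mu / t).
    rewrite [_ / _]mulrC; apply: cvgN; apply: cvgM; first exact: cvg_cst.
    exact: (cvg_at_right0_scale t1 (@vm_quotient_cvg m mu)).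
  apply: cvg_trans H; apply: near_eq_cvg; near=> h.
  have h0 : 0 < h by [].
  have h1 : h <= t by near: h; apply: nbhs_right_le; lra.
  rewrite /vm_quotient mixture_mixturel//; last first.
    apply/andP; split; first by apply: mulr_ge0; exact: ltW.
    by rewrite ler_pdivrMl ?mulr1; lra.
  rewrite /= (_ : t - _ = - h *: 1 + t); last by rewrite /GRing.scale/=; field; lra.
  rewrite /GRing.scale/=; field; lra.
Unshelve. all: by end_near. Qed.

(** On the right, J(mu_t) is J(mu) plus t times a convergent quotient; on the left, clamping makes
    the segment constant. *)
Lemma mixture_continuous0 mu nu :
  {for (0 : R), continuous (fun t : R => J (mixture t mu nu))}.
Proof.
apply/left_right_continuousP; split.
  apply: (@cvg_trans _ (J mu @[t --> (0 : R)^'-])); last first.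
    by rewrite mixture0; exact: cvg_cst.
  apply: near_eq_cvg; near=> t.
  have t0 : t < 0 by [].
  by rewrite mixture_le0// ltW.
have H : J mu + t * vm_quotient J mu nu t @[t --> 0^'+] --> J mu.
  rewrite -[X in _ --> X]addr0 -[X in _ --> _ + X](mul0r (vm_deriv J mu nu)).
  apply: cvgD; first exact: cvg_cst.
  apply: cvgM; last exact: vm_quotient_cvg.
  by apply: cvg_at_right_filter; exact: cvg_id.
rewrite mixture0; apply: cvg_trans H; apply: near_eq_cvg; near=> t.
have t0 : t != 0 by rewrite gt_eqF.
by rewrite /vm_quotient mulVKf// addrC subrK.
Unshelve. all: by end_near. Qed.

Context (L : R) (L_gt0 : 0 < L) (J_smooth : smooth J L).

Lemma influence_lipschitz mu nu x :
  `|influence J mu x - influence J nu x| <= L * tv_dist mu nu.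
Proof.
rewrite -lee_fin; apply: le_trans (J_smooth mu nu).
by apply: ereal_sup_ubound; exists x.
Qed.

(** Compare [mu] with the Dirac mass at [x], whose own influence at [x] is zero. *)
Lemma influence_bound mu x : `|influence J mu x| <= L.
Proof.
rewrite -[influence J mu x]subr0 -(influence_dirac x).
apply: (le_trans (influence_lipschitz _ _ _)).
by rewrite ler_piMr ?tv_dist_le1// ltW.
Qed.

Context (gap_max : forall mu, gap_attained J mu).

Lemma gap_le mu c : (forall x, - c <= influence J mu x) -> gap J mu <= c.
Proof.
move=> hc; apply: ge_sup; first by exists (- vm_deriv J mu mu), mu.
move=> _ [nu _ <-]; have [ih ->] := vm_deriv_influence mu nu.
have : \int[nu]_(x in setT) (cst (- c) x) <= \int[nu]_(x in setT) influence J mu x.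
  by apply: le_Rintegral => //; exact: finite_measure_integrable_cst.
rewrite Rintegral_cst//= probability_setT mulr1.
by rewrite lerNl.
Qed.

(** Attainment of the maximum bounds the set of values, so its real supremum is a genuine upper
    bound and not a default value. *)
Lemma gap_ge mu nu : - vm_deriv J mu nu <= gap J mu.
Proof.
have [nu0 nu0P] := gap_max mu; apply: ub_le_sup; last by exists nu.
by exists (- vm_deriv J mu nu0) => _ [nu' _ <-].
Qed.

Lemma gap_ge0 mu : 0 <= gap J mu.
Proof. by rewrite -oppr0 -(vm_deriv_self mu) gap_ge. Qed.

(* On the segment mu_t, (1 - t) d/dt J(mu_t) is the influence of mu_t at x,
   which is at most C + L t, with C the influence of mu at x; integrate. *)
Lemma descent mu x (eta : R) : 0 <= eta < 1 ->
  J (mixture eta mu (dirac x)) <=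
  J mu - (influence J mu x + L) * ln (1 - eta) - L * eta.
Proof.
move=> eta01; set C := influence J mu x.
pose g (t : R) := J (mixture t mu (dirac x)).
(* The claim is exactly [k eta <= k 0], so it suffices that [k] be nonincreasing. *)
pose k (t : R) := g t + (C + L) * ln (1 - t) + L * t.
have dg (t : R) : 0 < t < 1 -> is_derive t 1 k
    (influence J (mixture t mu (dirac x)) x / (1 - t) - (C + L) / (1 - t) + L).
  move=> t01.
  have dln : is_derive t 1 (fun s : R => ln (1 - s)) (- (1 - t)^-1).
    have dl : is_derive (1 - t) 1 (@ln R) (1 - t)^-1 by apply: is_derive1_ln; lra.
    have dB : is_derive t 1 (fun s : R => 1 - s) (-1).
      by have := is_deriveB (is_derive_cst (1 : R) t 1) (is_derive_id t 1); rewrite sub0r.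
    have := @is_derive1_comp _ (@ln R) (fun s : R => 1 - s) t _ _ dl dB.
    by rewrite mulrN1.
  have dJ := is_derive_mixture mu (dirac x) t01.
  by apply: is_derive_eq; rewrite /GRing.scale/= mulr1 mulrN.
have ck (t : R) : 0 <= t < 1 -> {for t, continuous k}.
  move=> t01; have [->|t0] := eqVneq t 0.
    apply: continuousD; last first.
      by apply: continuousM; [exact: cvg_cst|exact: cvg_id].
    apply: continuousD; first exact: mixture_continuous0.
    apply: continuousM; first exact: cvg_cst.
    apply: continuous_comp; last by apply: continuous_ln; lra.
    by apply: continuousB; [exact: cvg_cst|exact: cvg_id].
  have /dg dk : 0 < t < 1 by rewrite lt_neqAle eq_sym t0; lra.
  by apply: differentiable_continuous; apply/derivable1_diffP.
have : k eta <= k 0.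
  apply: (@ler0_derive1_le_cc _ k 0 eta); rewrite ?in_itv/= ?lexx; try lra.
  - by move=> y; rewrite in_itv/= => y01; have /dg : 0 < y < 1 by lra.
  - move=> y; rewrite in_itv/= => y01.
    have y01' : 0 < y < 1 by lra.
    have dk := dg _ y01'; rewrite derive1E derive_val.
    (* Over the common denominator the constant L cancels, and the numerator is nonpositive by the
       Lipschitz bound at distance at most y. *)
    rewrite [leLHS](_ : _ =
      (influence J (mixture y mu (dirac x)) x - C - L * y) / (1 - y));
      last by field; lra.
    apply: mulr_le0_ge0; last by rewrite invr_ge0; lra.
    have y01'' : 0 <= y <= 1 by lra.
    have := influence_lipschitz (mixture y mu (dirac x)) mu x.
    have := ler_wpM2l (ltW L_gt0) (tv_dist_mixture_le mu (dirac x) y01'').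
    rewrite -/C; move: (tv_dist _ _) => tv h1 /ler_normlW; lra.
  - apply: continuous_in_subspaceT => y; rewrite inE/= in_itv/= => y01.
    by apply: ck; lra.
rewrite /k/g mixture0 subr0 ln1 !mulr0 !addr0; lra.
Qed.

End vm_calculus.

(** * Deterministic bound along a Frank-Wolfe path *)

Lemma ln1B_ge (R : realType) (t : R) : 0 <= t < 1 ->
  t ^+ 2 / 2 - t <= (1 - t) * ln (1 - t).
Proof.
(* [q] vanishes at 0, and its derivative - ln (1 - s) - s is nonnegative since ln (1 - s) <= - s. *)
move=> t01; pose q (s : R) := (1 - s) * ln (1 - s) + s - s ^+ 2 / 2.
have dq (s : R) : s < 1 -> is_derive s 1 q (- ln (1 - s) - s).
  move=> s1.
  have dl : is_derive (1 - s) 1 (@ln R) (1 - s)^-1 by apply: is_derive1_ln; lra.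
  have dB : is_derive s 1 (fun s : R => 1 - s) (-1).
    by have := is_deriveB (is_derive_cst (1 : R) s 1) (is_derive_id s 1); rewrite sub0r.
  have dln : is_derive s 1 (fun s : R => ln (1 - s)) (- (1 - s)^-1).
    have := @is_derive1_comp _ (@ln R) (fun s : R => 1 - s) s _ _ dl dB.
    by rewrite mulrN1.
  apply: is_derive_eq; rewrite /GRing.scale/=; field; lra.
have : q 0 <= q t.
  apply: (@ger0_derive1_le_cc _ q 0 t); rewrite ?in_itv/= ?lexx; try lra.
  - by move=> y; rewrite in_itv/= => y01; have /dq : y < 1 by lra.
  - move=> y; rewrite in_itv/= => y01.
    have y1 : y < 1 by lra.
    have dk := dq _ y1; rewrite derive1E derive_val.
    have : ln (1 + - y) <= - y by apply: le_ln1Dx; lra.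
    lra.
  - apply: continuous_in_subspaceT => y; rewrite inE/= in_itv/= => y01.
    have /dq dk : y < 1 by lra.
    by apply: differentiable_continuous; apply/derivable1_diffP.
rewrite /q subr0 ln1; lra.
Qed.

Section frank_wolfe_path.
Context (d : measure_display) (T : measurableType d) (R : realType).
Context (J : probability T R -> R) (J_diff : forall mu, vm_differentiable J mu).
Context (L : R) (L_gt0 : 0 < L) (J_smooth : smooth J L).
Implicit Types (mu nu : probability T R).

Lemma vm_deriv_argmin_ge0 mu nu : (forall m, J mu <= J m) -> 0 <= vm_deriv J mu nu.
Proof.
move=> mu_min; apply: limr_ge; first exact: (J_diff mu).1.
near=> t; have t0 : 0 < t by [].
by rewrite /vm_quotient mulr_ge0 ?invr_ge0 ?(ltW t0)// subr_ge0.
Unshelve. all: by end_near. Qed.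

Lemma frank_wolfe_path_sum (n : nat) (mu : nat -> probability T R) (x : nat -> T)
    (mustar : probability T R) (eta : R) : (0 < n)%N ->
  (forall nu, J mustar <= J nu) ->
  0 <= eta <= 1 -> eta ^+ 2 * (L * n%:R) = 2 * (J (mu 0%N) - J mustar) ->
  (forall k, (k < n)%N -> mu k.+1 = mixture eta (mu k) (dirac (x k))) ->
  \sum_(k < n) - influence J (mu k) (x k) <= n%:R * L * eta.
Proof.
move=> n0 mustar_min eta01 etaE muS.
(* At eta = 1 the logarithm is out of reach, but the claim holds termwise because influences are
   bounded by L. *)
have [eta1|eta_neq1] := eqVneq eta 1.
  rewrite eta1 mulr1 mulr_natl -[in leRHS](card_ord n) -sumr_const.
  apply: ler_sum => k _.
  by have := influence_bound J_diff L_gt0 J_smooth (mu k) (x k); rewrite ler_norml; lra.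
(* At eta = 0 the path is constant and its starting point is a minimizer, where influences are
   nonnegative. *)
have [eta0|eta_neq0] := eqVneq eta 0.
  rewrite eta0 mulr0; apply: sumr_le0 => k _; rewrite oppr_le0.
  have muk0 : forall i, (i <= n)%N -> mu i = mu 0%N.
    by elim=> // i IH lin; rewrite muS// eta0 mixture0 IH// ltnW.
  rewrite muk0 ?(ltnW (ltn_ord k))//; apply: vm_deriv_argmin_ge0 => m.
  apply: le_trans (mustar_min m); move: etaE; rewrite eta0; lra.
have eta_lt1 : 0 <= eta < 1 by rewrite (andP eta01).1 lt_neqAle eta_neq1 (andP eta01).2.
pose l := - ln (1 - eta).
have l_gt0 : 0 < l by rewrite oppr_gt0 ln_lt0//; lra.
have tel m : (m <= n)%N -> J (mu m) <= J (mu 0%N) +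
    l * \sum_(k < m) influence J (mu k) (x k) + m%:R * (L * l - L * eta).
  elim: m => [_|m IH mn]; first by rewrite big_ord0; lra.
  rewrite muS// big_ord_recr/= -natr1.
  have := descent J_diff L_gt0 J_smooth (mu m) (x m) eta_lt1.
  have := IH (ltnW mn); rewrite /l; lra.
have := tel n (leqnn n); have := mustar_min (mu n).
have := ln1B_ge eta_lt1.
rewrite sumrN; move: (\sum_(k < n) _) => S h1 h2 h3.
(* Telescoping gives - l S <= J(mu_0) - J(mustar) + n L (l - eta), where the first difference is n L
   eta^2 / 2. The right side is at most l n L eta exactly when l (1 - eta) <= eta - eta^2 / 2. *)
rewrite -(ler_pM2l l_gt0).
have n_gt0 : 0 < n%:R :> R by rewrite ltr0n.
have Ln : 0 < L * n%:R by rewrite mulr_gt0.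
have : L * n%:R * (l * (1 - eta)) <= L * n%:R * (eta - eta ^+ 2 / 2).
  by rewrite ler_pM2l//; rewrite /l; lra.
move: h2 h3 etaE; lra.
Qed.

End frank_wolfe_path.

(** * Integration against laws and freezing of independent variables *)

Lemma measurable_integral_section (d1 d2 : measure_display)
    (T1 : measurableType d1) (T2 : measurableType d2) (R : realType)
    (m2 : {sigma_finite_measure set T2 -> \bar R}) (f : T1 * T2 -> \bar R) :
  measurable_fun setT f -> measurable_fun setT (fun x => \int[m2]_y f (x, y))%E.
Proof.
(* Without integrability, Tonelli still applies to each of the positive and negative parts. *)
move=> mf; under eq_fun do rewrite integralE.
apply: emeasurable_funB.
  have mfp : measurable_fun setT f^\+%E by exact: measurable_funepos.
  have h := @measurable_fun_fubini_tonelli_F _ _ _ _ _ m2 f^\+%E mfp (funepos_ge0 f).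
  by apply: eq_measurable_fun h => x _; apply: eq_integral => y _; rewrite !funeposE.
have mfn : measurable_fun setT f^\-%E by exact: measurable_funeneg.
have h := @measurable_fun_fubini_tonelli_F _ _ _ _ _ m2 f^\-%E mfn (funeneg_ge0 f).
by apply: eq_measurable_fun h => x _; apply: eq_integral => y _; rewrite !funenegE.
Qed.

(* Unlike integral_distribution, no integrability is assumed: without it, the
   conventional values of the two integrals still agree. *)
Lemma integral_distributionE (d d' : measure_display)
    (T : measurableType d) (T' : measurableType d') (R : realType)
    (P : probability T R) (X : {RV P >-> T'}) (f : T' -> \bar R) :
  measurable_fun setT f ->
  (\int[distribution P X]_y f y = \int[P]_x f (X x))%E.
Proof.
move=> mf; rewrite integralE [RHS]integralE; congr (_ - _)%E.
  rewrite ge0_integral_distribution//; last exact: measurable_funepos.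
  by apply: eq_integral => x _; rewrite /= !funeposE.
rewrite ge0_integral_distribution//; last exact: measurable_funeneg.
by apply: eq_integral => x _; rewrite /= !funenegE.
Qed.

Lemma measurable_integral_sample (d d1 d2 : measure_display)
    (Omega : measurableType d) (T1 : measurableType d1) (T2 : measurableType d2)
    (R : realType) (P : probability Omega R) (V : {RV P >-> T2})
    (f : T1 * T2 -> \bar R) :
  measurable_fun setT f ->
  measurable_fun setT (fun x => \int[P]_w f (x, V w))%E.
Proof.
move=> mf; have := measurable_integral_section (distribution P V) mf.
apply: eq_measurable_fun => x _; apply: integral_distributionE.
exact: measurableT_comp.
Qed.

Section independent_pair.
Local Open Scope ereal_scope.
Context (d d1 d2 : measure_display) (Omega : measurableType d)
  (T1 : measurableType d1) (T2 : measurableType d2) (R : realType).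
Context (P : probability Omega R) (Z : {mfun Omega >-> T1}) (V : {mfun Omega >-> T2}).
Context (indep : forall A B, measurable A -> measurable B ->
  P (Z @^-1` A `&` V @^-1` B) = P (Z @^-1` A) * P (V @^-1` B)).

Let pair_mfun : measurable_fun setT (fun w => (Z w, V w)).
Proof. exact: measurable_fun_pair. Qed.

Let ZV : {mfun Omega >-> (T1 * T2)%type} := mfun_Sub (mem_set pair_mfun).

Let joint_law C : measurable C ->
  (distribution P Z \x distribution P V) C = distribution P ZV C.
Proof. by move=> mC; apply: product_measure_unique => // A B mA mB; exact: indep. Qed.

(** By independence the joint law is the product law, and Tonelli freezes Z while V is averaged over
    an independent draw w'. *)
Lemma ge0_integral_indep (F : T1 * T2 -> \bar R) :
  measurable_fun setT F -> (forall z, 0 <= F z) ->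
  \int[P]_w F (Z w, V w) = \int[P]_w \int[P]_w' F (Z w, V w').
Proof.
move=> mF F0.
rewrite -(@ge0_integral_distribution _ _ _ _ _ P ZV)//.
rewrite [LHS](eq_measure_integral (distribution P Z \x distribution P V)); last first.
  by move=> A mA _; apply/esym; exact: joint_law.
rewrite fubini_tonelli1// ge0_integral_distribution//; last 2 first.
- exact: measurable_fun_fubini_tonelli_F.
- by move=> x; exact: integral_ge0.
apply: eq_integral => w _; rewrite /= /fubini_F ge0_integral_distribution//.
exact: measurableT_comp.
Qed.

Lemma integral_indep (F : T1 * T2 -> \bar R) :
  measurable_fun setT F -> P.-integrable setT (fun w => F (Z w, V w)) ->
  \int[P]_w F (Z w, V w) = \int[P]_w \int[P]_w' F (Z w, V w').
Proof.
move=> mF iF.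
have mFx x : measurable_fun setT (fun y => F (x, y)) by exact: measurableT_comp.
(* Integrability under P passes to the product law, which permits Fubini for signed F. *)
have iprod : (distribution P Z \x distribution P V).-integrable setT F.
  apply/integrableP; split=> //.
  rewrite (eq_measure_integral (distribution P ZV)); last first.
    by move=> A mA _; exact: joint_law.
  rewrite ge0_integral_distribution//; last exact: measurableT_comp.
  by have /integrableP[] := iF.
rewrite -(@integral_distribution _ _ _ _ _ P ZV)//.
rewrite [LHS](eq_measure_integral (distribution P Z \x distribution P V)); last first.
  by move=> A mA _; apply/esym; exact: joint_law.
rewrite -integral12_prod_meas1//.
have FE w : fubini_F (distribution P V) F (Z w) = \int[P]_w' F (Z w, V w').
  by rewrite /fubini_F integral_distributionE.
rewrite integral_distribution//; last 2 first.
- exact: (measurable_fubini_F iprod).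
- have /integrableP[mG iG] := integrable_fubini_F iprod.
  apply/integrableP; split; first exact: measurableT_comp.
  by move: iG; rewrite ge0_integral_distribution//; exact: measurableT_comp.
by apply: eq_integral => w _; exact: FE.
Qed.

End independent_pair.

(** * Independence of a whole sample from the past *)

Section independent_tuple.
Context (d dE : measure_display) (Omega : measurableType d) (E : measurableType dE).
Context (R : realType) (P : probability Omega R) (m : nat).
Context (Ys : 'I_m -> {RV P >-> E}).

Definition tuple_of_RVs (w : Omega) : m.-tuple E := [tuple Ys j w | j < m].

Lemma measurable_tuple_of_RVs : measurable_fun setT tuple_of_RVs.
Proof.
apply/measurable_fun_tnthP => i.
rewrite (_ : _ \o _ = Ys i)//.
by apply/funext => w /=; rewrite tnth_mktuple.
Qed.

HB.instance Definition _ :=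
  isMeasurableFun.Build _ _ _ _ tuple_of_RVs measurable_tuple_of_RVs.

Context (S : set_system Omega) (S_measurable : S `<=` measurable) (S_setT : S setT).
Context (indep : mutually_independent P
  (fun o : option 'I_m => if o is Some j then sigma_of (Ys j) else S)).

Lemma mutually_independent_Some :
  mutually_independent P (fun j => sigma_of (Ys j)).
Proof.
move=> K A KA; pose A' o := if o is Some j then A j else setT.
have := @indep (Some @: K)%SET A'.
rewrite big_imset/=; last by move=> ? ? _ _ [].
move=> <-; last by move=> _ /imsetP[j jK ->]; exact: KA.
congr (P _); apply/seteqP; split=> w h.
  by move=> _ /= /imsetP[j jK ->]; exact: h.
by move=> j jK; apply: (h (Some j)); rewrite /= mem_imset//; exact: Some_inj.
Qed.

Let rectangle (C : 'I_m -> set E) : set (m.-tuple E) :=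
  [set y | forall j, C j (tnth y j)].

Let rectangles : set_system (m.-tuple E) :=
  [set rectangle C | C in [set C | forall j, measurable (C j)]].

Let measurable_rectangle C : (forall j, measurable (C j)) -> measurable (rectangle C).
Proof.
move=> mC; rewrite (_ : rectangle C = \bigcap_(j in setT) ((@tnth _ E ^~ j) @^-1` C j)).
  apply: fin_bigcap_measurable => // j _.
  by rewrite -[X in measurable X]setTI; exact: measurable_tnth.
by apply/seteqP; split=> [y yC j _|y yC j]; exact: yC.
Qed.

Let rectanglesE : measurable = <<s rectangles >>.
Proof.
apply/seteqP; split.
  apply: smallest_sub; first exact: smallest_sigma_algebra.
  move=> B; rewrite -bigcup_seq => -[j /= _ [C mC <-]].
  (* A cylinder over coordinate j is a rectangle whose other sides are full. *)
  apply: sub_sigma_algebra; exists (fun i => if i == j then C else setT).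
    by move=> i /=; case: ifP.
  rewrite setTI; apply/seteqP; split=> y /= yC.
    by have := yC j; rewrite eqxx.
  by move=> i; case: eqP => // ->.
apply: smallest_sub; first exact: sigma_algebra_measurable.
by move=> _ [C mC <-]; exact: measurable_rectangle.
Qed.

Let rectanglesI : setI_closed rectangles.
Proof.
move=> _ _ [C mC <-] [C' mC' <-]; exists (fun j => C j `&` C' j).
  by move=> j; exact: measurableI.
apply/seteqP; split=> [y yC|y [yC yC'] j]; last by split.
by split=> j; have [] := yC j.
Qed.

Let indep_rectangle A C : S A -> (forall j, measurable (C j)) ->
  (P (A `&` tuple_of_RVs @^-1` rectangle C) =
   P A * \prod_(j < m) P (Ys j @^-1` C j))%E.
Proof.
move=> SA mC.
pose A' o := if o is Some j then Ys j @^-1` C j else A.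
have := @indep [set: option 'I_m]%SET A'.
rewrite (bigD1 None) ?inE//= => h.
rewrite (_ : A `&` _ = \bigcap_(i in [set` [set: option 'I_m]%SET]) A' i); last first.
  apply/seteqP; split=> [w [Aw wC] [j|] //=|w h'].
    by have := wC j; rewrite /= tnth_mktuple.
  split; first by apply: (h' None); rewrite /= inE.
  by move=> j; rewrite /= tnth_mktuple; apply: (h' (Some j)); rewrite /= inE.
rewrite h; last first.
  by move=> [j|] _ //=; exists (C j) => //; rewrite setTI.
congr (_ * _)%E.
rewrite (reindex_omap Some id)/=; last by case=> [j|] //; rewrite eqxx andbF.
by apply: eq_big => j; rewrite ?inE ?eqxx.
Qed.

(** For fixed A both sides are finite measures in B. They agree on rectangles, a generating family
    closed under intersection, hence everywhere. *)
Lemma indep_tuple A B : S A -> measurable B ->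
  (P (A `&` tuple_of_RVs @^-1` B) = P A * P (tuple_of_RVs @^-1` B))%E.
Proof.
move=> SA mB; have mA := S_measurable SA.
pose PA := NngNum (fine_ge0 (measure_ge0 P A)).
have PAE : PA%:num%:E = P A by rewrite /= fineK// fin_num_measure.
rewrite setIC -PAE.
apply: (@measure_unique _ _ _ rectangles (fun=> setT) rectanglesE rectanglesI _ _
  (pushforward (mrestr P mA) tuple_of_RVs)
  (mscale PA (distribution P tuple_of_RVs))) => //.
- by move=> _; exists (fun=> setT) => //; apply/seteqP.
- by rewrite bigcup_const.
- move=> _ [C mC <-].
  transitivity (P (tuple_of_RVs @^-1` rectangle C `&` A)) => //.
  rewrite setIC indep_rectangle// -PAE; congr (_ * _)%E.
  (* The case A = Omega identifies the product of the marginals with the law of the tuple. *)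
  have := indep_rectangle S_setT mC.
  by rewrite setTI probability_setT mul1e => <-.
- move=> _; apply: (@le_lt_trans _ _ 1%E); last exact: ltry.
  exact: (probability_le1 P (measurableI _ _ measurableT mA)).
Qed.

End independent_tuple.

(** * Measurability of the iterates with respect to the history *)

Section history.
Context (dO dE d : measure_display) (Omega : measurableType dO)
  (E : measurableType dE) (T : measurableType d) (R : realType)
  (P : probability Omega R) (m : nat).
Context (Ys : nat -> 'I_m -> {RV P >-> E}) (xhat : nat -> {RV P >-> T}).

Lemma history_measurable k : history Ys xhat k `<=` measurable.
Proof.
apply: smallest_sub; first exact: sigma_algebra_measurable.
by move=> A [i _ [[j [B mB <-]]|[B mB <-]]]; exact: measurable_funPT.
Qed.

Lemma history_setT k : history Ys xhat k setT.
Proof.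
by rewrite -setC0; apply: sigma_algebraC; exact: sigma_algebra0.
Qed.

Lemma sub_history k l : (k <= l)%N -> history Ys xhat k `<=` history Ys xhat l.
Proof.
move=> kl; apply: smallest_sub; first exact: smallest_sigma_algebra.
move=> A [i ik iA]; apply: sub_sigma_algebra; exists i => //.
exact: leq_trans ik kl.
Qed.

Context (mu : nat -> Omega -> probability T R) (mu0 : probability T R)
  (eta : R) (n : nat).
Context (eta01 : 0 <= eta <= 1) (mu_0 : forall w, mu 0%N w = mu0)
  (mu_S : forall k w, (k < n)%N -> mu k.+1 w = mixture eta (mu k w) (dirac (xhat k w))).

(** By induction each evaluation of mu_k at a measurable set is a measurable function of the points
    selected before step k, and evaluations generate the sigma-algebra on measures. *)
Lemma iterate_history k (U : set (pprobability T R)) : (k <= n)%N ->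
  measurable U -> history Ys xhat k (mu k @^-1` U).
Proof.
move=> kn.
pose G := [set A | exists2 i, (i < k)%N &
        (exists j, sigma_of (Ys i j) A) \/ sigma_of (xhat i) A].
(* [W] is Omega equipped with the history, so measurability from [W] means that preimages lie in the
   history. *)
pose W := g_sigma_algebraType G.
have mx i : (i < k)%N -> measurable_fun setT (xhat i : W -> T).
  move=> ik _ A mA; rewrite setTI; apply: sub_sigma_algebra; exists i => //.
  by right; exists A => //; rewrite setTI.
have mmu i A : (i <= k)%N -> measurable A ->
    measurable_fun setT (fun w : W => mu i w A).
  move=> + mA; elim: i => [_|i IH ik].
    by under eq_fun do rewrite mu_0; exact: measurable_cst.
  under eq_fun do rewrite mu_S ?(leq_trans ik)//= mixtureE//.
  apply: emeasurable_funD; apply: measurable_funeM.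
    exact: IH (ltnW ik).
  rewrite /dirac; apply/measurable_EFinP.
  by apply: measurableT_comp; [exact: measurable_indic|exact: mx].
have mk : measurable_fun setT (mu k : W -> pprobability T R).
  apply: (measurability (@pset _ _ _ : set (set (pprobability T R)))) => //.
  move=> _ [_ [r r01] [A mA <-] <-]; rewrite setTI /mset.
  have := emeasurable_fun_infty_o measurableT (mmu k A (leqnn k) mA) r%:E.
  by rewrite setTI.
by move=> mU; have := mk measurableT U mU; rewrite setTI.
Qed.

End history.

(** * Expectations of the oracle, of its error and of its minimum *)

Lemma integral_fin_num_integrable (d : measure_display) (T : measurableType d)
    (R : realType) (mu : {measure set T -> \bar R}) (f : T -> \bar R) :
  measurable_fun setT f -> (\int[mu]_x f x \is a fin_num)%E ->
  mu.-integrable setT f.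
Proof.
move=> mf; rewrite integralE => fin; apply/integrableP; split=> //.
have mfp : measurable_fun setT f^\+%E by exact: measurable_funepos.
have mfn : measurable_fun setT f^\-%E by exact: measurable_funeneg.
under eq_integral do rewrite -[(`|f _|)%E]/((abse \o f) _) fune_abse.
rewrite ge0_integralD//; move: fin.
have : (0 <= \int[mu]_x f^\+ x)%E by exact: integral_ge0.
have : (0 <= \int[mu]_x f^\- x)%E by exact: integral_ge0.
(* Even the difference of two infinite parts is infinite by convention, so a finite integral forces
   both parts to be finite. *)
case: (\int[mu]_x f^\+ x)%E => [p| |]; case: (\int[mu]_x f^\- x)%E => [q| |] //.
by rewrite -EFinD ltry.
Qed.

Lemma same_law_integral (d d' dE : measure_display) (Omega : measurableType d)
    (Omega' : measurableType d') (E : measurableType dE) (R : realType)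
    (P : probability Omega R) (P' : probability Omega' R)
    (Y : {RV P >-> E}) (Y' : {RV P' >-> E}) (f : E -> \bar R) :
  same_law Y Y' -> measurable_fun setT f ->
  (\int[P]_w f (Y w) = \int[P']_w f (Y' w))%E.
Proof.
move=> law mf; rewrite -!integral_distributionE//.
by apply: eq_measure_integral => A mA _; exact: law.
Qed.

Section oracle_facts.
Local Open Scope ereal_scope.
Context (d dO dE : measure_display) (T : measurableType d) (R : realType)
  (Omega : measurableType dO) (E : measurableType dE)
  (P : probability Omega R) (Y : {RV P >-> E})
  (H : probability T R -> T -> E -> R)
  (J : probability T R -> R) (J_diff : forall mu, vm_differentiable J mu)
  (L : R) (L_gt0 : (0 < L)%R) (J_smooth : smooth J L)
  (H_measurable : oracle_measurable H J) (H_unbiased : unbiased Y H J)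
  (c0 : R) (H_error : oracle_error_bound Y H J c0)
  (gap_max : forall mu, gap_attained J mu).
Context (m : nat) (m_gt0 : (0 < m)%N).

Definition oracle_min (z : pprobability T R * m.-tuple E) : \bar R :=
  ereal_inf (range (fun x => (oracle_mean H z.2 z.1 x)%:E)).

Let err (z : pprobability T R * m.-tuple E) : \bar R := oracle_error H J z.2 z.1.

Lemma oracle_mean_dist mu y x :
  `|oracle_mean H y mu x - influence J mu x|%:E <= oracle_error (m := m) H J y mu.
Proof. by apply: ereal_sup_ubound; exists x. Qed.

Lemma oracle_error_ge0 mu y : 0 <= oracle_error (m := m) H J y mu.
Proof. by apply: le_trans (oracle_mean_dist mu y point); rewrite lee_fin. Qed.

(** Every oracle mean is within the error of an influence lying in [-L, L]. This envelope yields
    integrability of the minimum. *)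
Lemma oracle_min_bound z : `|oracle_min z| <= L%:E + err z.
Proof.
case: z => mu y; rewrite /err/=.
have := oracle_mean_dist mu y; have := oracle_error_ge0 mu y.
case: (oracle_error _ _ _ _) => [e|_ _|//]; last by rewrite addey// leey.
rewrite lee_fin => e0 he.
have hb x : (- (L + e) <= oracle_mean H y mu x <= L + e)%R.
  have := he x; rewrite lee_fin.
  have := influence_bound J_diff L_gt0 J_smooth mu x.
  by rewrite !ler_norml; lra.
have : (- (L + e))%:E <= oracle_min (mu, y).
  by apply: le_ereal_inf_tmp => _ [x _ <-]; rewrite lee_fin; have /andP[] := hb x.
have : oracle_min (mu, y) <= (L + e)%:E.
  apply: (@le_trans _ _ (oracle_mean H y mu point)%:E).
    by apply: ereal_inf_lbound; exists point.
  by rewrite lee_fin; have /andP[] := hb point.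
case: (oracle_min _) => // r; rewrite -EFinD abse_EFin !lee_fin ler_norml; lra.
Qed.

Context (Ys : 'I_m -> {RV P >-> E}) (Ys_law : forall j, same_law Y (Ys j))
  (Ys_indep : mutually_independent P (fun j => sigma_of (Ys j))).

Lemma measurable_oracle_min : measurable_fun setT oracle_min.
Proof. by have [_ /(_ m m_gt0)[]] := H_measurable. Qed.

Lemma measurable_err : measurable_fun setT err.
Proof. by have [_ /(_ m m_gt0)[]] := H_measurable. Qed.

Let measurable_sample (F : pprobability T R * m.-tuple E -> \bar R) mu :
  measurable_fun setT F -> measurable_fun setT (fun w => F (mu, tuple_of_RVs Ys w)).
Proof.
move=> mF; apply: (measurableT_comp (g := fun w : Omega =>
  ((mu : pprobability T R), tuple_of_RVs Ys w)) mF).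
by apply: measurable_fun_pair => //; exact: measurable_cst.
Qed.

Lemma integral_oracle_error mu :
  \int[P]_w err (mu, tuple_of_RVs Ys w) <= (c0 / Num.sqrt m%:R)%:E.
Proof.
have s0 : (0 < Num.sqrt m%:R :> R)%R by rewrite sqrtr_gt0 ltr0n.
have := H_error mu m_gt0 Ys_law Ys_indep.
rewrite ge0_integralZl//; last 2 first.
- exact: (measurable_sample mu measurable_err).
- by move=> w _; exact: oracle_error_ge0.
by rewrite mulrC EFinM lee_pdivlMl.
Qed.

(** Integrability is extracted from unbiasedness, since the expectation has a finite value. *)
Lemma integral_sample mu x j :
  P.-integrable setT (fun w => (H mu x (Ys j w))%:E) /\
  \int[P]_w (H mu x (Ys j w))%:E = (influence J mu x)%:E.
Proof.
have mH : measurable_fun setT (fun e => (H mu x e)%:E).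
  apply/measurable_EFinP.
  apply: (measurableT_comp (proj1 H_measurable)
    (g := fun e => ((mu : pprobability T R, x), e))).
  exact: measurable_fun_pair.
have := H_unbiased mu x; rewrite unlock => <-.
rewrite (same_law_integral (Ys_law j) mH); split=> //.
apply: integral_fin_num_integrable; first exact: (measurableT_comp mH).
rewrite -(same_law_integral (Ys_law j) mH).
by have := H_unbiased mu x; rewrite unlock => ->.
Qed.

Lemma integral_oracle_mean mu x :
  P.-integrable setT (fun w => (oracle_mean H (tuple_of_RVs Ys w) mu x)%:E) /\
  \int[P]_w (oracle_mean H (tuple_of_RVs Ys w) mu x)%:E = (influence J mu x)%:E.
Proof.
have omE w : (oracle_mean H (tuple_of_RVs Ys w) mu x)%:E =
    (m%:R^-1)%:E * \sum_(j < m) (H mu x (Ys j w))%:E.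
  rewrite /oracle_mean EFinM -sumEFin; congr (_ * _).
  by apply: eq_bigr => j _; rewrite tnth_mktuple.
have isum : P.-integrable setT (fun w => \sum_(j < m) (H mu x (Ys j w))%:E).
  by apply: integrable_sum => // j _; have [] := integral_sample mu x j.
split; first by under eq_fun do rewrite omE; exact: integrableZl.
under eq_integral do rewrite omE.
rewrite integralZl// integral_sum//; last first.
  by move=> j; have [] := integral_sample mu x j.
rewrite (eq_bigr (fun=> (influence J mu x)%:E)); last first.
  by move=> j _; have [] := integral_sample mu x j.
rewrite sumEFin -EFinM sumr_const card_ord -[X in (_ * X)%R]mulr_natl mulKf//.
by rewrite pnatr_eq0 -lt0n.
Qed.

Lemma integrable_err mu : P.-integrable setT (fun w => err (mu, tuple_of_RVs Ys w)).
Proof.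
apply/integrableP; split.
  exact: (measurable_sample mu measurable_err).
under eq_integral do rewrite gee0_abs ?oracle_error_ge0//.
by rewrite (le_lt_trans (integral_oracle_error mu)) ?ltry.
Qed.

Lemma integrable_oracle_min mu :
  P.-integrable setT (fun w => oracle_min (mu, tuple_of_RVs Ys w)).
Proof.
apply: (@le_integrable _ _ _ _ _ _ _ (fun w => L%:E + err (mu, tuple_of_RVs Ys w))) => //.
- exact: (measurable_sample mu measurable_oracle_min).
- by move=> w _; rewrite (le_trans (oracle_min_bound _))// lee_abs.
- apply: integrableD => //; last exact: integrable_err.
  exact: finite_measure_integrable_cst.
Qed.

(** The mean of an infimum is at most each of the means, and these are the influences. *)
Lemma integral_oracle_min_le mu x :
  \int[P]_w oracle_min (mu, tuple_of_RVs Ys w) <= (influence J mu x)%:E.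
Proof.
have [iom <-] := integral_oracle_mean mu x.
apply: le_integral => //; first exact: integrable_oracle_min.
by move=> w _; apply: ereal_inf_lbound; exists x.
Qed.

(* Measurability of the gap in mu is not known, so independence cannot be
   applied to it directly; it is dominated by this function of mu, which is
   measurable by Fubini and has the right mean along the iterates. *)
Definition smoothed_gap mu : \bar R :=
  - \int[P]_w oracle_min (mu, tuple_of_RVs Ys w).

Lemma measurable_smoothed_gap :
  measurable_fun setT (smoothed_gap : pprobability T R -> _).
Proof.
apply: measurableT_comp => //.
exact: (@measurable_integral_sample _ _ _ _ _ _ _ P (tuple_of_RVs Ys) _
  measurable_oracle_min).
Qed.

Lemma gap_le_smoothed_gap mu : (gap J mu)%:E <= smoothed_gap mu.
Proof.
have fin := integrable_fin_num measurableT (integrable_oracle_min mu).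
rewrite /smoothed_gap -(fineK fin) -EFinN lee_fin; apply: (gap_le J_diff) => x.
by rewrite opprK -lee_fin fineK// integral_oracle_min_le.
Qed.

End oracle_facts.

(** * The stochastic recursion in expectation *)

Section stochastic_frank_wolfe.
Local Open Scope ereal_scope.
Context (R : realType) (d dO dE : measure_display) (S : measurableType d)
  (Omega : measurableType dO) (E : measurableType dE).
Context (J : probability S R -> R)
  (J_diff : forall mu, vm_differentiable J mu)
  (gap_max : forall mu, gap_attained J mu)
  (L : R) (L_gt0 : (0 < L)%R) (J_smooth : smooth J L)
  (mustar : probability S R) (mustar_min : forall mu, (J mustar <= J mu)%R).
Context (P : probability Omega R) (Y : {RV P >-> E})
  (H : probability S R -> S -> E -> R)
  (H_measurable : oracle_measurable H J)
  (H_unbiased : unbiased Y H J)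
  (c0 : R) (H_error : oracle_error_bound Y H J c0).
Context (n : nat) (n_gt0 : (0 < n)%N) (mu0 : probability S R) (eta : R)
  (eta01 : (0 <= eta <= 1)%R)
  (eta_sqr : (eta ^+ 2 * (L * n%:R) = 2 * (J mu0 - J mustar))%R).
Context (Ys : nat -> 'I_n -> {RV P >-> E}) (xhat : nat -> {RV P >-> S})
  (mu : nat -> Omega -> probability S R)
  (Ys_law : forall k j, (k < n)%N -> same_law Y (Ys k j))
  (Ys_fresh : forall k, (k < n)%N ->
    mutually_independent P (fun o : option 'I_n =>
      if o is Some j then sigma_of (Ys k j) else history Ys xhat k))
  (mu_0 : forall w, mu 0%N w = mu0)
  (mu_S : forall k w, (k < n)%N ->
    mu k.+1 w = mixture eta (mu k w) (dirac (xhat k w)))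
  (xhat_argmin : forall k w x, (k < n)%N ->
    (oracle_mean H [tuple Ys k j w | j < n] (mu k w) (xhat k w) <=
     oracle_mean H [tuple Ys k j w | j < n] (mu k w) x)%R).

Let lawY (k : 'I_n) j : same_law Y (Ys k j).
Proof. exact: Ys_law. Qed.

Let indepY (k : 'I_n) : mutually_independent P (fun j => sigma_of (Ys k j)).
Proof. exact: (mutually_independent_Some (Ys_fresh (ltn_ord k))). Qed.

Let iterate_measurable (k : 'I_n) :
  measurable_fun setT (mu k : Omega -> pprobability S R).
Proof.
move=> _ U mU; rewrite setTI; apply: (@history_measurable _ _ _ _ _ _ _ _ _ Ys xhat k).
exact: (iterate_history eta01 mu_0 mu_S (ltnW (ltn_ord k)) mU).
Qed.

Let Z (k : 'I_n) : {mfun Omega >-> pprobability S R} :=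
  mfun_Sub (mem_set (iterate_measurable k)).

Let V (k : 'I_n) : {mfun Omega >-> n.-tuple E} := tuple_of_RVs (Ys k).

(** The iterate is determined by the history, from which the samples of step k are independent. *)
Let indepZV (k : 'I_n) A B : measurable A -> measurable B ->
  P (Z k @^-1` A `&` V k @^-1` B) = P (Z k @^-1` A) * P (V k @^-1` B).
Proof.
move=> mA mB.
apply: (indep_tuple (@history_measurable _ _ _ _ _ _ _ _ _ Ys xhat k)
  (@history_setT _ _ _ _ _ _ _ _ _ Ys xhat k) (Ys_fresh (ltn_ord k))) => //.
exact: (iterate_history eta01 mu_0 mu_S (ltnW (ltn_ord k)) mA).
Qed.

Let err (k : 'I_n) w : \bar R := oracle_error H J (tuple_of_RVs (Ys k) w) (mu k w).

Let omin (k : 'I_n) w : \bar R := oracle_min H (mu k w, tuple_of_RVs (Ys k) w).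

Let sgap (k : 'I_n) := smoothed_gap H (Ys k).

Let measurable_step (F : pprobability S R * n.-tuple E -> \bar R) (k : 'I_n) :
  measurable_fun setT F ->
  measurable_fun setT (fun w => F (mu k w, tuple_of_RVs (Ys k) w)).
Proof.
move=> mF; apply: (measurableT_comp (g := fun w : Omega =>
  ((mu k w : pprobability S R), tuple_of_RVs (Ys k) w)) mF).
exact: measurable_fun_pair.
Qed.

Let merr_k k : measurable_fun setT (err k).
Proof. exact: (measurable_step k (measurable_err H_measurable n_gt0)). Qed.

Let momin_k k : measurable_fun setT (omin k).
Proof. exact: (measurable_step k (measurable_oracle_min H_measurable n_gt0)). Qed.

Let msgap k : measurable_fun setT (sgap k).
Proof. exact: (measurable_smoothed_gap H_measurable n_gt0 (Ys k)). Qed.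

Let msgap_k k : measurable_fun setT (fun w => sgap k (mu k w)).
Proof. exact: (measurableT_comp (g := Z k) (@msgap k)). Qed.

(** Freezing mu_k reduces the claim to the error bound at a fixed measure, which is uniform in that
    measure. *)
Let integral_err k : \int[P]_w err k w <= (c0 / Num.sqrt n%:R)%:E.
Proof.
have mF := measurable_err H_measurable n_gt0.
have := ge0_integral_indep (@indepZV k) mF.
move=> /(_ (fun z => oracle_error_ge0 _ _ _ _)) /= ->.
have errle := integral_oracle_error H_measurable H_error n_gt0 (@lawY k) (@indepY k).
apply: (@le_trans _ _ (\int[P]_w (c0 / Num.sqrt n%:R)%:E)); last first.
  by rewrite integral_cst//= probability_setT mule1.
apply: ge0_le_integral => //.
- by move=> w _; apply: integral_ge0 => w' _; exact: oracle_error_ge0.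
- exact: (measurableT_comp (g := Z k)
    (@measurable_integral_sample _ _ _ _ _ _ _ P (V k) _ mF)).
- by move=> w _; exact: errle.
Qed.

Let ierr k : P.-integrable setT (err k).
Proof.
apply/integrableP; split=> //.
under eq_integral do rewrite gee0_abs ?oracle_error_ge0//.
by rewrite (le_lt_trans (integral_err k)) ?ltry.
Qed.

Let iomin k : P.-integrable setT (omin k).
Proof.
apply: (@le_integrable _ _ _ _ _ _ _ (fun w => L%:E + err k w)) => //.
- move=> w _; apply: (@le_trans _ _ (L%:E + err k w)); last exact: lee_abs.
  exact: (oracle_min_bound _ J_diff L_gt0 J_smooth).
- apply: integrableD => //; exact: finite_measure_integrable_cst.
Qed.

Let sgap_ge0 k m : 0 <= sgap k m.
Proof.
apply: (@le_trans _ _ (gap J m)%:E); first by rewrite lee_fin gap_ge0.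
exact: (gap_le_smoothed_gap J_diff L_gt0 J_smooth H_measurable H_unbiased
  H_error n_gt0 (@lawY k) (@indepY k)).
Qed.

(** Freezing mu_k shows that resampling in the smoothed gap and using the actual samples of step k
    have the same mean. *)
Let integral_sgap k : \int[P]_w sgap k (mu k w) = - \int[P]_w omin k w.
Proof.
have mF := measurable_oracle_min H_measurable n_gt0.
have -> : \int[P]_w omin k w = \int[P]_w (- sgap k (mu k w)).
  have := integral_indep (@indepZV k) mF (@iomin k) => /= ->.
  by apply: eq_integral => w _; rewrite /sgap /smoothed_gap oppeK.
by rewrite [in RHS]integral_ge0N ?oppeK// => w _.
Qed.

Let path_bound w : (- (n%:R * L * eta))%:E <= \sum_(k < n) (omin k w + err k w).
Proof.
have path : (\sum_(k < n) - influence J (mu k w) (xhat k w) <= n%:R * L * eta)%R.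
  apply: (frank_wolfe_path_sum J_diff L_gt0 J_smooth (mu := mu ^~ w)
    (x := xhat ^~ w) n_gt0 mustar_min eta01); first by rewrite mu_0.
  by move=> k kn; exact: mu_S.
apply: (@le_trans _ _ (\sum_(k < n) (influence J (mu k w) (xhat k w))%:E)).
  by rewrite sumEFin lee_fin lerNl -sumrN.
apply: lee_sum => k _.
(* The selected point attains the infimum, so its influence is at most the minimum plus the
   error. *)
have ominE : (oracle_mean H (tuple_of_RVs (Ys k) w) (mu k w) (xhat k w))%:E <= omin k w.
  apply: le_ereal_inf_tmp => _ [x _ <-]; rewrite lee_fin.
  exact: xhat_argmin.
apply: le_trans (leeD ominE (oracle_mean_dist H J (mu k w) _ (xhat k w))).
by rewrite -EFinD lee_fin -lerBlDl -opprB lerNl; apply: lerNnormlW.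
Qed.

(** Integrate the pathwise bound: the means of the minima become minus those of the smoothed gaps,
    and each error contributes at most c0 / sqrt n. *)
Lemma sum_integral_smoothed_gap_le :
  \sum_(k < n) \int[P]_w smoothed_gap H (Ys k) (mu k w) <=
  (n%:R * (L * eta + c0 / Num.sqrt n%:R))%:E.
Proof.
have fo k := integrable_fin_num measurableT (iomin k).
have fe k := integrable_fin_num measurableT (ierr k).
have ioe k : P.-integrable setT (fun w => omin k w + err k w) by exact: integrableD.
have : \int[P]_w (- (n%:R * L * eta))%:E <= \int[P]_w \sum_(k < n) (omin k w + err k w).
  apply: le_integral => //; first exact: finite_measure_integrable_cst.
  by apply: integrable_sum => // k _; exact: ioe.
rewrite integral_cst//= probability_setT mule1 integral_sum//.
rewrite (eq_bigr (fun k =>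
  (fine (\int[P]_w omin k w) + fine (\int[P]_w err k w))%:E)); last first.
  by move=> k _; rewrite integralD// EFinD !fineK.
rewrite sumEFin lee_fin => h.
rewrite (eq_bigr (fun k => (- fine (\int[P]_w omin k w))%:E)); last first.
  by move=> k _; rewrite integral_sgap EFinN fineK//; exact: fo.
rewrite sumEFin lee_fin.
have : (\sum_(k < n) fine (\int[P]_w err k w) <= n%:R * (c0 / Num.sqrt n%:R))%R.
  rewrite (_ : _ * _ = \sum_(k < n) (c0 / Num.sqrt n%:R))%R; last first.
    by rewrite sumr_const card_ord mulr_natl.
  apply: ler_sum => k _.
  by have := integral_err k; rewrite -[X in X <= _](fineK (fe k)) lee_fin.
move: h; rewrite big_split/= sumrN; lra.
Qed.

(** * Averaging over the random index *)

Context (gap_measurable : forall k, (k < n)%N ->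
    measurable_fun setT (fun w => gap J (mu k w)))
  (a : Omega -> 'I_n)
  (a_measurable : forall i, measurable (a @^-1` [set i]))
  (a_uniform : forall i, P (a @^-1` [set i]) = (n%:R^-1)%:E)
  (a_indep : mutually_independent P (fun b : bool =>
    if b then preimage_set_system setT a setT else history Ys xhat n)).

Let select (k : 'I_n) : Omega -> R := \1_(a @^-1` [set k]).

Let mselect k : measurable_fun setT (select k).
Proof. exact: measurable_indic. Qed.

Let selectRV k : {mfun Omega >-> R} := mfun_Sub (mem_set (@mselect k)).

Let selectE k w : select k w = (a w == k)%:R :> R.
Proof.
rewrite /select indicE; congr (_%:R); congr nat_of_bool.
by apply/idP/eqP => [/set_mem|aw]; [|apply/mem_set].
Qed.

Let indep_select (k : 'I_n) A B : measurable A -> measurable B ->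
  P (Z k @^-1` A `&` selectRV k @^-1` B) =
  P (Z k @^-1` A) * P (selectRV k @^-1` B).
Proof.
move=> mA mB.
pose C b := if b then selectRV k @^-1` B else Z k @^-1` A.
have := @a_indep [set: bool]%SET C.
rewrite (eq_bigl xpredT); last by move=> b; rewrite inE.
rewrite big_bool/= muleC => <-.
  congr (P _); apply/seteqP; split=> [w [ZA sB] [] _ //|w h].
  by split; [apply: (h false)|apply: (h true)]; rewrite /= inE.
move=> [] _ /=; last first.
  apply: (sub_history (ltnW (ltn_ord k))).
  exact: (iterate_history eta01 mu_0 mu_S (ltnW (ltn_ord k)) mA).
(* The indicator of a = k is a function of the index, so this event is a preimage under [a]. *)
exists [set i | B (i == k)%:R] => //; rewrite setTI.
by apply/seteqP; split=> w /=; rewrite -/(select k w) selectE.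
Qed.

Let integral_selected k :
  \int[P]_w (sgap k (mu k w) * (select k w)%:E) =
  (n%:R^-1)%:E * \int[P]_w sgap k (mu k w).
Proof.
(* The absolute value makes the integrand nonnegative on the whole product space and leaves
   indicators unchanged. *)
have mF : measurable_fun setT
    (fun z : pprobability S R * R => sgap k z.1 * `|z.2|%:E).
  apply: emeasurable_funM; first exact: (measurableT_comp (@msgap k)).
  by apply/measurable_EFinP; apply: measurableT_comp => //; apply: measurableT_comp.
have := ge0_integral_indep (@indep_select k) mF.
have absE w : `|select k w|%R = select k w by rewrite selectE normr_nat.
move=> /(_ (fun z => mule_ge0 (sgap_ge0 _ _) _)) /=.
under eq_integral do rewrite absE.
move=> ->; last by move=> z; rewrite lee_fin.
rewrite -ge0_integralZl//; apply: eq_integral => w _.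
under eq_integral do rewrite absE.
rewrite ge0_integralZl//.
- by rewrite muleC integral_indic//= setIT a_uniform.
- exact/measurable_EFinP.
- by move=> w' _; rewrite lee_fin selectE.
Qed.

(** Split the gap at the random iterate over the values of [a], dominate each term by the smoothed
    gap, and only then use independence, each index having mass 1 / n. *)
Lemma expectation_gap_le :
  'E_P[fun w => gap J (mu (a w) w)] <=
  (n%:R^-1)%:E * \sum_(k < n) \int[P]_w smoothed_gap H (Ys k) (mu k w).
Proof.
have gapE w : (gap J (mu (a w) w))%:E =
    \sum_(k < n) ((gap J (mu k w))%:E * (select k w)%:E).
  rewrite (bigD1 (a w))//= selectE eqxx mule1 big1 ?adde0// => k.
  by rewrite eq_sym => /negPf ka; rewrite selectE ka mule0.
have mgap (k : 'I_n) :
    measurable_fun setT (fun w => (gap J (mu k w))%:E * (select k w)%:E).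
  apply: emeasurable_funM; apply/measurable_EFinP => //.
  exact: gap_measurable.
rewrite unlock; under eq_integral do rewrite gapE.
have s0 k w : 0 <= (select k w)%:E :> \bar R by rewrite lee_fin selectE.
rewrite ge0_integral_sum//; last first.
  by move=> k w _; rewrite mule_ge0// lee_fin gap_ge0.
rewrite ge0_sume_distrr; last by move=> k _; apply: integral_ge0 => w _; exact: sgap_ge0.
apply: lee_sum => k _; rewrite -integral_selected.
apply: ge0_le_integral => //.
- by move=> w _; rewrite mule_ge0// lee_fin gap_ge0.
- by apply: emeasurable_funM => //; exact/measurable_EFinP.
- move=> w _; apply: lee_wpmul2r => //.
  exact: (gap_le_smoothed_gap J_diff L_gt0 J_smooth H_measurable H_unbiased
    H_error n_gt0 (@lawY k) (@indepY k)).
Qed.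

End stochastic_frank_wolfe.

(** * Assembling the bound and its constants *)

Theorem theorem5 (R : realType) (d : nat) (X : set 'rV[R]_d)
  (X0 : X !=set0) (X_compact : compact X)
  (J : probability (borel X0) R -> R)
  (J_diff : forall mu, vm_differentiable J mu)
  (gap_max : forall mu, gap_attained J mu)
  (L : R) (L_gt0 : 0 < L) (J_smooth : smooth J L)
  (mustar : probability (borel X0) R)
  (mustar_min : forall mu, J mustar <= J mu)
  (D : R) (D_def : D = tv_diameter (borel X0) R) (D_gt0 : 0 < D)
  (dO dE : measure_display) (Omega : measurableType dO) (E : measurableType dE)
  (P : probability Omega R) (Y : {RV P >-> E})
  (H : probability (borel X0) R -> borel X0 -> E -> R)
  (H_measurable : oracle_measurable H J)
  (H_unbiased : unbiased Y H J)
  (c0 : R) (H_error : oracle_error_bound Y H J c0)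
  (T : nat) (T_ge1 : (1 <= T)%N)
  (mu0 : probability (borel X0) R)
  (eta : R)
  (eta_def : eta =
    Num.sqrt (2 * (J mu0 - J mustar) / (L * D ^+ 2 * T%:R)))
  (eta_le1 : eta <= 1)
  (Ys : nat -> 'I_T -> {RV P >-> E})
  (xhat : nat -> {RV P >-> borel X0})
  (mu : nat -> Omega -> probability (borel X0) R)
  (Ys_law : forall k j, (k < T)%N -> same_law Y (Ys k j))
  (Ys_fresh : forall k, (k < T)%N ->
    mutually_independent P (fun o : option 'I_T =>
      if o is Some j then sigma_of (Ys k j) else history Ys xhat k))
  (mu_0 : forall w, mu 0%N w = mu0)
  (mu_S : forall k w, (k < T)%N ->
    mu k.+1 w = mixture eta (mu k w) (dirac (xhat k w)))
  (xhat_argmin : forall k w x, (k < T)%N ->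
    oracle_mean H [tuple Ys k j w | j < T] (mu k w) (xhat k w) <=
    oracle_mean H [tuple Ys k j w | j < T] (mu k w) x)
  (gap_measurable : forall k, (k < T)%N ->
    measurable_fun setT (fun w => gap J (mu k w)))
  (a : Omega -> 'I_T)
  (a_measurable : forall i, measurable (a @^-1` [set i]))
  (a_uniform : forall i, P (a @^-1` [set i]) = (T%:R^-1)%:E)
  (a_indep : mutually_independent P (fun b : bool =>
    if b then preimage_set_system setT a setT else history Ys xhat T)) :
  ('E_P[fun w => gap J (mu (a w) w)] <=
   (D / Num.sqrt T%:R * (c0 + Num.sqrt (2 * L * (J mu0 - J mustar))))%:E)%E.
Proof.
have D1 : D = 1 by rewrite D_def tv_diameter_gt0_eq1// -D_def.
have n_gt0 : 0 < T%:R :> R by rewrite ltr0n.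
have Delta_ge0 : 0 <= J mu0 - J mustar by rewrite subr_ge0.
have eta_ge0 : 0 <= eta by rewrite eta_def sqrtr_ge0.
have eta01 : 0 <= eta <= 1 by rewrite eta_ge0.
have eta_sqr : eta ^+ 2 * (L * T%:R) = 2 * (J mu0 - J mustar).
  rewrite eta_def D1 expr1n mulr1 sqr_sqrtr; last first.
    by apply: divr_ge0; apply: mulr_ge0 => //; exact: ltW.
  by rewrite divfK// mulf_neq0 ?gt_eqF.
have sT_gt0 : 0 < Num.sqrt T%:R :> R by rewrite sqrtr_gt0.
(* With D = 1 this turns the target into L eta + c0 / sqrt T, the average of the summed bounds. *)
have sqrtE : Num.sqrt (2 * L * (J mu0 - J mustar)) = L * eta * Num.sqrt T%:R.
  rewrite (_ : 2 * L * _ = (L * eta * Num.sqrt T%:R) ^+ 2).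
    by rewrite sqrtr_sqr ger0_norm// !mulr_ge0// ltW.
  rewrite !exprMn sqr_sqrtr ?ltW//.
  by transitivity (L * (eta ^+ 2 * (L * T%:R))); [rewrite eta_sqr|]; ring.
apply: (le_trans (expectation_gap_le J_diff gap_max L_gt0 J_smooth H_measurable
  H_unbiased H_error T_ge1 eta01 Ys_law Ys_fresh mu_0 mu_S gap_measurable
  a_measurable a_uniform a_indep)).
have := sum_integral_smoothed_gap_le J_diff gap_max L_gt0 J_smooth mustar_min
  H_measurable H_unbiased H_error T_ge1 eta01 eta_sqr Ys_law Ys_fresh mu_0 mu_S
  xhat_argmin.
move/(lee_wpmul2l (x := (T%:R^-1)%:E)) => /(_ _)/le_trans; apply.
  by rewrite lee_fin invr_ge0 ltW.
rewrite -EFinM lee_fin mulKf ?gt_eqF// D1 sqrtE.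
rewrite [leRHS](_ : _ = L * eta + c0 / Num.sqrt T%:R)//.
by field; rewrite gt_eqF.
Qed.
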